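(* In the trilevel setting, let $\Omega:=\{x\in\mathrm{Fix}(W):\langle (I-T)x,y-x\rangle\ge0\ \forall y\in\mathrm{Fix}(W)\}$ be nonempty. Assume $\lim_{k\to\infty}\beta_k/\alpha_k=+\infty$, $\alpha_k\to0$, $\sum_k\alpha_k=\infty$, there is $K>0$ with $\limsup_{k}\frac1{\alpha_k}\left|\frac1{\beta_k}-\frac1{\beta_{k-1}}\right|\le K$, $\limsup_{k}\frac{|\beta_k-\beta_{k-1}|+|\alpha_k-\alpha_{k-1}|}{\alpha_k\beta_k}=0$, and that the trilevel iteration sequence $\{x^k\}$ is bounded. Suppose further $(A_1)'$ $\limsup_{k\to\infty}\frac{d(x^{k+1},\mathrm{Fix}(W))}{\beta_k}=0$, and $(A_2)$ $\limsup_{k\to\infty}\beta_k^2/\alpha_k<\infty$. Then $\{x^k\}$ converges to the unique $x^*\in\Omega$ satisfying $\langle x^*-S(x^* ),x-x^*\rangle\ge0$ for all $x\in\Omega$.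
   Context: Trilevel setting. Let $f_1,f_2:\mathbb R^n\to\mathbb R$ be convex and continuously differentiable with $L_{f_i}$-Lipschitz gradients, and $g_1,g_2:\mathbb R^n\to(-\infty,+\infty]$ proper, lower semicontinuous and convex; put $\phi_i=f_i+g_i$. Let $\omega:\mathbb R^n\to\mathbb R$ be $\mu$-strongly convex and continuously differentiable with $L_\omega$-Lipschitz gradient. Let $Y^*=\arg\min_{x\in\mathbb R^n}\phi_2(x)$ and $X^*=\arg\min_{x\in Y^*}\phi_1(x)$, both assumed nonempty. For a proper lsc convex $g$, $\mathrm{prox}_g(x)=\arg\min_{u}\{g(u)+\tfrac12\|u-x\|^2\}$. Fix $u\in(0,\tfrac{2}{L_\omega+\mu}]$, $t\in(0,1/L_{f_1}]$, $s\in(0,1/L_{f_2}]$ and define $S(x)=x-u\nabla\omega(x)$, $T(x)=\mathrm{prox}_{tg_1}(x-t\nabla f_1(x))$, $W(x)=\mathrm{prox}_{sg_2}(x-s\nabla f_2(x))$. Then $S$ is a contraction with constant $r=\sqrt{1-\tfrac{2u\mu L_\omega}{\mu+L_\omega}}\in[0,1)$, $T,W$ are nonexpansive, $\mathrm{Fix}(W)=Y^*$. Given $x^0\in\mathbb R^n$ and real sequences $\alpha_k,\beta_k\in(0,1)$, the trilevel iteration sequence is $x^{k+1}=\alpha_kS(x^k)+(1-\alpha_k)\beta_kT(x^k)+(1-\alpha_k)(1-\beta_k)W(x^k)$, $k\ge0$. $I$ is the identity, $d(x,A)=\inf_{a\in A}\|x-a\|$. *)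

(* Defs.v *)
From HB Require Import structures.
From mathcomp Require Import all_boot all_order all_algebra.
From mathcomp Require Import all_classical all_reals all_analysis.
Set Implicit Arguments. Unset Strict Implicit. Unset Printing Implicit Defensive.
Import Order.TTheory GRing.Theory Num.Theory.
Import numFieldNormedType.Exports.
Local Open Scope classical_set_scope.
Local Open Scope ring_scope.

Section Defs.
Variables (R : realType) (n : nat).
Local Notation vec := 'rV[R]_n.

Definition dot (u v : vec) : R := \sum_(i < n) u ord0 i * v ord0 i.
Definition enorm (u : vec) : R := Num.sqrt (dot u u).

Definition dist_set (x : vec) (A : set vec) : R :=
  inf [set enorm (x - a) | a in A].

Definition lipschitz_with (L : R) (F : vec -> vec) : Prop :=
  forall x y, enorm (F x - F y) <= L * enorm (x - y).

Definition convex_fun (f : vec -> R) : Prop :=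
  forall x y (l : R), 0 <= l <= 1 ->
    f (l *: x + (1 - l) *: y) <= l * f x + (1 - l) * f y.

Definition strongly_convex (mu : R) (f : vec -> R) : Prop :=
  forall x y (l : R), 0 <= l <= 1 ->
    f (l *: x + (1 - l) *: y) <=
      l * f x + (1 - l) * f y - mu / 2 * l * (1 - l) * enorm (x - y) ^+ 2.

(* convexity for extended-real valued functions into (-oo, +oo] *)
Definition econvex_fun (g : vec -> \bar R) : Prop :=
  forall (x y : vec) (l : R), 0 <= l <= 1 ->
    let z := l *: x + (1 - l) *: y in (g z <= l%:E * g x + (1 - l)%:E * g y)%E.

Definition proper_fun (g : vec -> \bar R) : Prop :=
  (exists x, g x != +oo%E) /\ (forall x, g x != -oo%E).

Definition lsc_fun (g : vec -> \bar R) : Prop :=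
  forall a : R, closed [set x | (g x <= a%:E)%E].

Definition has_gradient (f : vec -> R) (G : vec -> vec) : Prop :=
  forall x, differentiable f x /\ forall h, 'd f x h = dot (G x) h.

Definition is_prox (g : vec -> \bar R) (x p : vec) : Prop :=
  forall u, let a := enorm (p - x) ^+ 2 / 2 in let b := enorm (u - x) ^+ 2 / 2 in
    (g p + a%:E <= g u + b%:E)%E.

Definition argmin_on (phi : vec -> \bar R) (A : set vec) : set vec :=
  [set x | A x /\ forall y, A y -> (phi x <= phi y)%E].

Definition Fix (F : vec -> vec) : set vec := [set x | F x = x].

End Defs.

(* Main.v *)
(* Once S is known to be a contraction and T, W nonexpansive, put
   D_k = |x_(k+1) - x_k|.  Subtracting consecutive steps gives D_k -> 0 and then
   D_k / beta_k -> 0.  Pairing x_k - x_(k+1) with x_k - z for z in Fix W and dividing by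
   beta_k gives limsup <(I - T) z, x_k - z> <= 0, so that, by Minty's lemma, every
   cluster point lies in Omega.  Since I - S = u grad omega, the solution x* of the
   variational inequality is the minimizer of omega over Omega.  Finally
     |x_(k+1) - x*|^2 <= (1 - (1 - q) alpha_k) |x_k - x*|^2
        + 2 alpha_k <S x* - x*, x_(k+1) - x*>
        + 2 (1 - alpha_k) beta_k <T x* - x*, x_(k+1) - x*>,
   where the first inner product has limsup <= 0 by the cluster point argument and the
   second is at most a multiple of d(x_(k+1), Fix W) because x* is in Omega, hence
   beta_k <T x* - x*, x_(k+1) - x*> <= o(beta_k^2) = o(alpha_k). *)
Require Import Defs.
From HB Require Import structures.
From mathcomp Require Import all_boot all_order all_algebra.
From mathcomp Require Import all_classical all_reals all_analysis.
From mathcomp Require Import ring lra.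
Import Order.TTheory GRing.Theory Num.Theory.
Import numFieldNormedType.Exports.
Local Open Scope classical_set_scope.
Local Open Scope ring_scope.

Set Implicit Arguments.
Unset Strict Implicit.
Unset Printing Implicit Defensive.

(** * Euclidean geometry of row vectors *)

Section Euclid.
Variables (R : realType) (n : nat).
Implicit Types (u v w x y z : 'rV[R]_n) (a b c : R).

Lemma dotC u v : dot u v = dot v u.
Proof. by apply: eq_bigr => i _; rewrite mulrC. Qed.

Lemma dotDl u v w : dot (u + v) w = dot u w + dot v w.
Proof. by rewrite /dot -big_split; apply: eq_bigr => i _; rewrite mxE mulrDl. Qed.

Lemma dotZl a u w : dot (a *: u) w = a * dot u w.
Proof. by rewrite /dot mulr_sumr; apply: eq_bigr => i _; rewrite mxE mulrA. Qed.

Lemma dotNl u w : dot (- u) w = - dot u w.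
Proof. by rewrite -scaleN1r dotZl mulN1r. Qed.

Lemma dotDr u v w : dot w (u + v) = dot w u + dot w v.
Proof. by rewrite dotC dotDl !(dotC w). Qed.

Lemma dotZr a u w : dot w (a *: u) = a * dot w u.
Proof. by rewrite dotC dotZl dotC. Qed.

Lemma dotNr u w : dot w (- u) = - dot w u.
Proof. by rewrite dotC dotNl dotC. Qed.

Definition dotE := (dotDl, dotDr, dotNl, dotNr, dotZl, dotZr).

Lemma dot_ge0 u : 0 <= dot u u.
Proof. by apply: sumr_ge0 => i _; rewrite -expr2 sqr_ge0. Qed.

Lemma dot_le0_eq0 u : dot u u <= 0 -> u = 0.
Proof.
move=> u0; have /eqP : dot u u = 0 by apply/eqP; rewrite eq_le u0 dot_ge0.
rewrite psumr_eq0 => [/allP h|i _]; last by rewrite -expr2 sqr_ge0.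
apply/rowP => i; rewrite mxE.
by have := h i (mem_index_enum i); rewrite -expr2 sqrf_eq0 => /eqP ->.
Qed.

Lemma enorm_ge0 u : 0 <= enorm u.
Proof. exact: sqrtr_ge0. Qed.

Lemma sqr_enorm u : enorm u ^+ 2 = dot u u.
Proof. by rewrite sqr_sqrtr ?dot_ge0. Qed.

Lemma enorm_le c u : 0 <= c -> dot u u <= c ^+ 2 -> enorm u <= c.
Proof. by move=> c0; rewrite -sqr_enorm ler_pXn2r // nnegrE enorm_ge0. Qed.

Lemma dot_le c u : enorm u <= c -> dot u u <= c ^+ 2.
Proof.
move=> uc; rewrite -sqr_enorm ler_pXn2r // nnegrE ?enorm_ge0 //.
exact: le_trans (enorm_ge0 u) uc.
Qed.

Lemma enorm_eq0 u : enorm u <= 0 -> u = 0.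
Proof. by move=> /dot_le; rewrite expr0n => /dot_le0_eq0. Qed.

Lemma enorm_dot_le u v : dot u u <= dot v v -> enorm u <= enorm v.
Proof. by move=> h; apply: enorm_le; rewrite ?enorm_ge0 ?sqr_enorm. Qed.

Lemma enorm0 : enorm (0 : 'rV[R]_n) = 0.
Proof.
apply/eqP; rewrite eq_le enorm_ge0 andbT; apply: enorm_le => //.
by rewrite -(scale0r 0) dotZl mul0r expr0n.
Qed.

Lemma enormZ a u : enorm (a *: u) = `|a| * enorm u.
Proof.
rewrite /enorm !dotE mulrA -expr2 sqrtrM ?sqr_ge0 //.
by rewrite sqrtr_sqr.
Qed.

Lemma enormN u : enorm (- u) = enorm u.
Proof. by rewrite /enorm !dotE opprK. Qed.

Lemma enormC u v : enorm (u - v) = enorm (v - u).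
Proof. by rewrite -enormN opprB. Qed.

(** Cauchy-Schwarz: expanding the squared norm of [enorm v *: u - enorm u *: v] gives
    [2 * e * f * (e * f - d) >= 0], and [e * f] cancels once both vectors are nonzero. *)
Lemma dot_le_enorm u v : dot u v <= enorm u * enorm v.
Proof.
have [->|v0] := eqVneq v 0.
  by rewrite enorm0 mulr0 -(scale0r 0) dotZr mul0r.
have V0 : 0 < enorm v.
  by rewrite lt_neqAle enorm_ge0 andbT eq_sym; apply: contra_neq v0 => h;
     apply: enorm_eq0; rewrite h.
have := dot_ge0 (enorm v *: u - enorm u *: v).
rewrite !dotE (dotC v u) -!sqr_enorm.
set e := enorm u; set f := enorm v in V0 *; set d := dot u v => h.
have e0 : 0 <= e by exact: enorm_ge0.
have [e0'|e0'] := eqVneq e 0.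
  have -> : d = 0.
    by rewrite /d (@enorm_eq0 u) -/e ?e0' // -(scale0r 0) dotZl mul0r.
  by rewrite e0' mul0r.
have ef : 0 < e * f by rewrite mulr_gt0 // lt_neqAle eq_sym e0' e0.
rewrite -(ler_pM2l ef); nra.
Qed.

Lemma enormD u v : enorm (u + v) <= enorm u + enorm v.
Proof.
apply: enorm_le; first by rewrite addr_ge0 ?enorm_ge0.
rewrite !dotE (dotC v u) -!sqr_enorm.
by have := dot_le_enorm u v; nra.
Qed.

Lemma enormB u v : enorm (u - v) <= enorm u + enorm v.
Proof. by rewrite -(enormN v) enormD. Qed.

Lemma ge_enormN u v : - (enorm u * enorm v) <= dot u v.
Proof. by rewrite lerNl -dotNl (le_trans (dot_le_enorm _ _)) // enormN. Qed.

Lemma enormDB u v w : enorm (u - w) <= enorm (u - v) + enorm (v - w).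
Proof. by apply: le_trans (enormD _ _); rewrite addrA subrK. Qed.

Lemma mx_norm_le_enorm u : `|u| <= enorm u.
Proof.
rewrite /Num.norm /= mx_normrE.
apply/bigmax_leP; split => [|[i j] _]; first exact: enorm_ge0.
rewrite /= (ord1 i) -sqrtr_sqr ler_wsqrtr // /dot (bigD1 j) //= -expr2 lerDl.
by apply: sumr_ge0 => k _; rewrite -expr2 sqr_ge0.
Qed.

(** The topology on row vectors comes from the sup norm, so convergence statements pass through this
    comparison; the crude factor [n] is enough. *)
Lemma enorm_le_mx_norm u : enorm u <= n%:R * `|u|.
Proof.
apply: enorm_le; first by rewrite mulr_ge0.
have -> : (n%:R * `|u|) ^+ 2 = n%:R * (n%:R * `|u| ^+ 2).
  by rewrite exprMn expr2 mulrA.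
apply: (@le_trans _ _ (\sum_(i < n) `|u| ^+ 2)).
  apply: ler_sum => i _; rewrite -expr2 -real_normK ?num_real //.
  rewrite ler_pXn2r ?nnegrE //.
  rewrite {2}/Num.norm /= mx_normrE.
  exact: (@le_bigmax _ _ _ 0 (fun ij : 'I_1 * 'I_n => `|u ij.1 ij.2|) (ord0, i)).
rewrite sumr_const card_ord -[leLHS]mulr_natl.
case: n u => [|m] u; first by rewrite !mul0r.
by rewrite ler_wpM2l // ler_peMl ?sqr_ge0 // ler1n.
Qed.

(** Cluster points along the indices satisfying [P]; the predicate replaces an explicit
    subsequence. *)
Definition limit_pt (x : nat -> 'rV[R]_n) (P : nat -> Prop) (p : 'rV[R]_n) :=
  forall e, 0 < e -> forall N, exists k, [/\ (N <= k)%N, P k & enorm (x k - p) < e].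

(** Bolzano-Weierstrass: a closed sup-norm ball is compact, and the image of [\oo] restricted to [P]
    is a proper filter containing it. *)
Lemma bounded_limit_pt (x : nat -> 'rV[R]_n) (P : nat -> Prop) (M : R) :
  (forall k, enorm (x k) <= M) -> (forall N, exists2 k, (N <= k)%N & P k) ->
  exists p, limit_pt x P p.
Proof.
move=> xM Pinf.
pose A := [set y : 'rV[R]_n | `|y| <= M].
have cA : compact A.
  apply: bounded_closed_compact.
    by exists M; split; [exact: num_real|move=> N MN y /= yM; rewrite (le_trans yM) // ltW].
  have -> : A = closed_ball_ Num.norm 0 M.
    by apply/seteqP; split => y; rewrite /A /closed_ball_ /= sub0r normrN.
  exact: closed_closed_ball_.
pose F := x @ (within P \oo).
have PF : ProperFilter F.
  apply: fmap_proper_filter; apply: Build_ProperFilter_ex.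
  move=> B [N _ hN]; have [k Nk Pk] := Pinf N.
  by exists k; exact: hN.
have FA : F A.
  exists 0%N => //= k _ _ /=; exact: le_trans (mx_norm_le_enorm _) (xM k).
have [p [_ clp]] := cA F PF FA.
exists p => e e0 N.
(* Dividing by [n.+1] instead of [n] keeps the radius positive in dimension 0. *)
have n0 : 0 < n.+1%:R :> R by rewrite ltr0n.
pose B := [set x k | k in [set k | (N <= k)%N /\ P k]].
have FB : F B by exists N => //= k Nk Pk; exists k.
have Bp : nbhs p (ball p (e / n.+1%:R)) by apply: nbhsx_ballx; rewrite divr_gt0.
have [y [[k [Nk Pk] <-]]] := clp _ _ FB Bp.
rewrite -ball_normE /= => h; exists k; split => //.
apply: (le_lt_trans (enorm_le_mx_norm _)).
rewrite distrC ltr_pdivlMr // in h.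
apply: le_lt_trans h; rewrite mulrC ler_wpM2l //.
by rewrite ler_nat.
Qed.

Lemma enorm_cvg (x : nat -> 'rV[R]_n) (p : 'rV[R]_n) :
  (forall e, 0 < e -> \forall k \near \oo, enorm (x k - p) <= e) -> x @ \oo --> p.
Proof.
move=> h; apply/cvgrPdist_le => e e0; near=> k.
rewrite distrC (le_trans (mx_norm_le_enorm _)) //; near: k; exact: h.
Unshelve. all: by end_near. Qed.

Lemma line_derive (f : 'rV[R]_n -> R) G x (h : 'rV[R]_n) (t : R) : has_gradient f G ->
  is_derive t 1 (fun s : R => f (x + s *: h)) (dot (G (x + t *: h)) h).
Proof.
move=> fG; have [df dfE] := fG (x + t *: h).
have E : (fun l : R => l^-1 *: (f (x + (l *: 1 + t) *: h) - f (x + t *: h))) =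
  (fun l : R => l^-1 *: (f (l *: h + (x + t *: h)) - f (x + t *: h))).
  apply/funext => l; congr (_ *: (f _ - _)).
  by rewrite scalerDl -[l *: 1]/(l * 1) mulr1 addrCA.
have := @diff_derivable _ _ _ _ _ h df; have := @deriveE _ _ _ _ _ h df.
rewrite /derivable /derive dfE => dE cvE; apply: DeriveDef.
  by rewrite /derivable /= E.
by rewrite /derive /= E.
Qed.

End Euclid.

(** * Gradient and proximal steps *)

(** Divide by [l] and let [l] tend to 0. Every first-order optimality condition below is obtained in
    this way. *)
Lemma ge0_of_small_quadratic (R : realType) (a b : R) :
  (forall l, 0 < l <= 1 -> 0 <= l * a + l ^+ 2 * b) -> 0 <= a.
Proof.
move=> h; apply/ler_addgt0Pr => e e0.
have b0 : 0 < `|b| + 1 by rewrite ltr_pwDr.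
pose l := Num.min 1 (e / (`|b| + 1)).
have l0 : 0 < l by rewrite lt_min ltr01 divr_gt0.
have l1 : l <= 1 by rewrite ge_min lexx.
have le : l * (`|b| + 1) <= e by rewrite -ler_pdivlMr // ge_min lexx orbT.
have := h l; rewrite l0 l1 => /(_ isT); rewrite expr2 -mulrA -mulrDr pmulr_rge0 //.
have : l * b <= l * (`|b| + 1).
  by apply: ler_wpM2l; [exact: ltW|have := ler_norm b; lra].
lra.
Qed.

(** * Smooth functions: descent lemma, cocoercivity, gradient step *)

Section Smooth.
Variables (R : realType) (n : nat) (f : 'rV[R]_n -> R) (G : 'rV[R]_n -> 'rV[R]_n).
Variables (L mu : R).
Hypotheses (fG : has_gradient f G) (GL : lipschitz_with L G).
Implicit Types (x y z h : 'rV[R]_n).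

Let line x h (s : R) := f (x + s *: h).

Lemma line_continuous x h : {within `[0, 1], continuous (line x h)}.
Proof.
apply: continuous_subspaceT => s; apply: differentiable_continuous.
by apply/derivable1_diffP; have [] := line_derive x h s fG.
Qed.

(** Descent lemma. The mean value theorem is applied to [f] along the segment minus the claimed
    quadratic bound; the derivative of this difference is nonpositive. *)
Lemma lipschitz_gradient_upper x h :
  f (x + h) <= f x + dot (G x) h + L / 2 * dot h h.
Proof.
pose phi s := line x h s - (s * dot (G x) h + s ^+ 2 * (L / 2 * dot h h)).
pose dphi s := dot (G (x + s *: h)) h - (dot (G x) h + s * (L * dot h h)).
have dphiE (s : R) : is_derive s 1 phi (dphi s).
  have := line_derive x h s fG; rewrite -/(line x h) => lE.
  apply: is_derive_eq; rewrite /GRing.scale /= !(mul0r, mulr0, addr0, mulr1, mul1r).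
  by rewrite /dphi; field.
have cphi : {within `[0, 1], continuous phi}.
  apply: continuous_subspaceT => s; apply: differentiable_continuous.
  by apply/derivable1_diffP; have [] := dphiE s.
have [c] := MVT ltr01 (fun s _ => dphiE s) cphi.
rewrite in_itv /= => /andP[c0 c1].
have : dphi c <= 0.
  rewrite /dphi opprD addrA -dotNl -dotDl subr_le0.
  apply: le_trans (dot_le_enorm _ _) _.
  apply: (@le_trans _ _ (L * enorm (c *: h) * enorm h)).
    by rewrite ler_wpM2r ?enorm_ge0 //; have := GL (x + c *: h) x; rewrite [x + _ - x]addrAC subrr add0r.
  by rewrite enormZ gtr0_norm // -sqr_enorm; lra.
rewrite /phi /line scale1r scale0r addr0; lra.
Qed.

(** A crude constant is enough: the bound only serves with [l *: h] for [h], where the error is of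
    order [l ^+ 2]. *)
Lemma lipschitz_gradient_lower x h :
  f x + dot (G x) h - `|L| * dot h h <= f (x + h).
Proof.
have [c] := MVT ltr01 (fun s _ => line_derive x h s fG) (line_continuous (x:=x) (h:=h)).
rewrite in_itv /= => /andP[c0 c1]; rewrite scale1r scale0r addr0 subr0 mulr1 => E.
have : - (`|L| * dot h h) <= dot (G (x + c *: h) - G x) h.
  apply: le_trans (ge_enormN _ _); rewrite lerN2.
  apply: (@le_trans _ _ (`|L| * enorm (c *: h) * enorm h)).
    rewrite ler_wpM2r ?enorm_ge0 //; have := GL (x + c *: h) x.
    rewrite addrAC subrr add0r => /le_trans; apply.
    by rewrite ler_wpM2r ?enorm_ge0 // ler_norm.
  rewrite enormZ (gtr0_norm c0) -sqr_enorm -!mulrA ler_wpM2l //.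
  by rewrite expr2 ler_piMl // ?mulr_ge0 ?enorm_ge0 // ltW.
rewrite !dotE; lra.
Qed.

Hypothesis fmu : strongly_convex mu f.

Lemma strongly_convex_lower x y :
  f x + dot (G x) (y - x) + mu / 2 * dot (y - x) (y - x) <= f y.
Proof.
set h := y - x; rewrite -subr_ge0.
apply: (@ge0_of_small_quadratic _ _ ((mu / 2 + `|L|) * dot h h)) => l /andP[l0 l1].
have := @fmu y x l; rewrite l1 ltW // => /(_ isT).
have -> : l *: y + (1 - l) *: x = x + l *: h.
  by rewrite scalerBl scale1r scalerBr addrCA.
have := lipschitz_gradient_lower x (l *: h).
rewrite sqr_enorm -/h !dotE; lra.
Qed.

(* Baillon-Haddad for [f - mu/2 |.|^2]: compare the lower bound at [y] with the
   upper bound at [z], both evaluated at [z + d] with [d] a multiple of the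
   difference [h] of the corrected gradients. *)
Lemma gradient_cocoercive (tau : R) y z :
  let h := G z - G y - mu *: (z - y) in
  (2 * tau - (L - mu) * tau ^+ 2) * dot h h <= dot h (z - y).
Proof.
have half (a b : 'rV[R]_n) : let h := G b - G a - mu *: (b - a) in
    f a + dot (G a) (b - a) + mu / 2 * dot (b - a) (b - a)
      + (tau - (L - mu) / 2 * tau ^+ 2) * dot h h <= f b.
  set h := G b - G a - mu *: (b - a) => /=.
  pose d := (- tau) *: h.
  have := strongly_convex_lower a (b + d).
  have := lipschitz_gradient_upper b d.
  have -> : b + d - a = (b - a) + d by rewrite addrAC.
  have hd : dot (G b) d = dot (G a) d + mu * dot (b - a) d - tau * dot h h.
    have : dot h d = - tau * dot h h by rewrite /d dotZr.
    by rewrite /h (dotDl _ _ d) (dotDl _ _ d) !dotNl dotZl -/h; lra.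
  have dd : dot d d = tau ^+ 2 * dot h h by rewrite /d dotZl dotZr; ring.
  rewrite (dotDl (b - a)) !(dotDr (b - a) d) (dotC d (b - a)) hd dd; lra.
rewrite /=; set h := G z - G y - mu *: (z - y); have := half y z; have := half z y.
have -> : G y - G z - mu *: (y - z) = - h.
  by rewrite /h -(opprB z y) -(opprB (G z)) scalerN -opprD.
have e : dot (G y) (z - y) = dot (G z) (z - y) - mu * dot (z - y) (z - y) - dot h (z - y).
  by rewrite /h !(dotDl _ _ (z - y)) !dotNl dotZl !(dotDl _ _ (z - y)) !dotNl; ring.
rewrite e -(opprB z y) /= -/h !dotNl !dotNr; lra.
Qed.

(** The difference of the two steps is [(1 - u * mu) *: D - u *: h]. Expanding its square reduces
    the claim to [u * hh <= 2 * (1 - u * mu) * hD], which follows from cocoercivity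
    [hh <= (L - mu) * hD] and [u * (L + mu) <= 2]. *)
Lemma gradient_step_le (u : R) x y : 0 < L + mu -> 0 < u <= 2 / (L + mu) ->
  enorm ((x - u *: G x) - (y - u *: G y)) <= `|1 - u * mu| * enorm (x - y).
Proof.
move=> Lmu /andP[u0]; rewrite ler_pdivlMr // => uL.
have [->|xy] := eqVneq x y; first by rewrite !subrr enorm0 mulr0.
set D := x - y; pose h := G x - G y - mu *: D.
have D0 : 0 < dot D D.
  rewrite lt_neqAle dot_ge0 andbT eq_sym; apply: contra_neq xy => E.
  by apply/eqP; rewrite -subr_eq0; apply/eqP/dot_le0_eq0; rewrite E.
have muL : mu <= L.
  have := strongly_convex_lower y x; have := lipschitz_gradient_upper y (x - y).
  by rewrite addrCA subrr addr0 -/D => h1 h2; nra.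
have cc := gradient_cocoercive _ y x; rewrite /= -/D -/h in cc.
apply: enorm_le; first by rewrite mulr_ge0 ?enorm_ge0.
have -> : (x - u *: G x) - (y - u *: G y) = (1 - u * mu) *: D - u *: h.
  by rewrite /h /D; apply/rowP => i; rewrite !mxE; ring.
clearbody h D; rewrite exprMn real_normK ?num_real // sqr_enorm !dotE (dotC D h).
set hh := dot h h in cc *; set hD := dot h D in cc *.
have hh0 : 0 <= hh by exact: dot_ge0.
suff : u * hh <= 2 * (1 - u * mu) * hD by nra.
(* If [L = mu], the quadratic term in [tau] disappears from the cocoercivity bound, and a large
   [tau] forces [hh = 0]. Otherwise [tau = (L - mu)^-1] is optimal. *)
have [LE|LN] := eqVneq L mu.
  have -> : hh = 0.
    apply/eqP; rewrite eq_le hh0 andbT; apply: contraT; rewrite -ltNge => hp.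
    have := cc (`|hD| / hh + 1); rewrite LE subrr mul0r subr0.
    have -> : 2 * (`|hD| / hh + 1) * hh = 2 * `|hD| + 2 * hh by field; rewrite gt_eqF.
    have := ler_norm hD; have := normr_ge0 hD; lra.
  have := cc 0; rewrite !(mulr0, mul0r, expr0n, subrr) /= => hD0.
  by rewrite !mulr_ge0 //; subst; lra.
have c0 : 0 < L - mu by rewrite subr_gt0 lt_neqAle eq_sym LN.
have := cc (L - mu)^-1.
have -> : 2 * (L - mu)^-1 - (L - mu) * (L - mu)^-1 ^+ 2 = (L - mu)^-1.
  by field; rewrite gt_eqF.
rewrite mulrC ler_pdivrMr // => h1.
have h2 : u * (L - mu) <= 2 * (1 - u * mu) by lra.
have hD0 : 0 <= hD by move: (le_trans hh0 h1); rewrite pmulr_lge0.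
apply: (@le_trans _ _ (u * (hD * (L - mu)))); first by rewrite ler_wpM2l // ltW.
by rewrite mulrCA [leLHS]mulrC ler_wpM2r.
Qed.

End Smooth.

Lemma convex_strongly_convex0 (R : realType) (n : nat) (f : 'rV[R]_n -> R) :
  convex_fun f -> strongly_convex 0 f.
Proof. by move=> cf x y l l01; rewrite !mul0r subr0; exact: cf. Qed.

(** * Proximal maps *)

Section Prox.
Variables (R : realType) (n : nat) (g : 'rV[R]_n -> \bar R) (c : R).
Hypotheses (c0 : 0 < c) (gp : proper_fun g) (gc : econvex_fun g).
Implicit Types (x y p q : 'rV[R]_n).

Lemma is_prox_fin x p : is_prox (fun z => (c%:E * g z)%E) x p ->
  exists a : R, g p = a%:E.
Proof.
move=> hp; have [[z gz] gN] := gp; have := hp z => /=.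
have := gN z; have := gN p; case: (g z) gz => [b| |] // _.
by case: (g p) => [a _ _ _| |] //; [exists a|rewrite gt0_muley ?lte_fin].
Qed.

(** First-order optimality of [p]: compare it with [p + l *: (q - p)], use convexity of [g], and let
    [l] tend to 0. *)
Lemma is_prox_variational x p q (a b : R) :
  is_prox (fun z => (c%:E * g z)%E) x p -> g p = a%:E -> g q = b%:E ->
  c * (a - b) <= dot (p - x) (q - p).
Proof.
move=> hp ga gb; rewrite -subr_ge0.
apply: (@ge0_of_small_quadratic _ _ (dot (q - p) (q - p) / 2)) => l /andP[l0 l1].
have := @gc q p l; rewrite l1 ltW // => /(_ isT) /=.
have := hp (l *: q + (1 - l) *: p) => /=.
have [_ gN] := gp; have := gN (l *: q + (1 - l) *: p).
rewrite ga gb; case: (g _) => [r| |] //= _.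
rewrite -!EFinM -!EFinD !lee_fin !sqr_enorm.
have -> : l *: q + (1 - l) *: p - x = (p - x) + l *: (q - p).
  by apply/rowP => i; rewrite !mxE; ring.
rewrite (dotDl (p - x)) !(dotDr (p - x)) (dotC (l *: (q - p))) dotZr dotZl dotZr.
move=> h1 /(ler_wpM2l (ltW c0)) h2; lra.
Qed.

(** Adding the two variational inequalities gives firm nonexpansiveness; nonnegativity of the square
    of [(x - y) - (p - q)] then bounds [p - q]. *)
Lemma prox_nonexpansive x y p q :
  is_prox (fun z => (c%:E * g z)%E) x p -> is_prox (fun z => (c%:E * g z)%E) y q ->
  enorm (p - q) <= enorm (x - y).
Proof.
move=> hp hq; have [a ga] := is_prox_fin hp; have [b gb] := is_prox_fin hq.
have := is_prox_variational hp ga gb; have := is_prox_variational hq gb ga => h1 h2.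
rewrite enormC; apply: enorm_dot_le.
have := dot_ge0 ((x - y) + (q - p)).
have : dot (q - p) (x - y) = - dot (p - x) (q - p) - dot (q - y) (p - q) - dot (q - p) (q - p).
  rewrite (dotC (p - x)) (dotC (q - y)) -(opprB q p) dotNl opprK -dotNr -dotDr.
  by rewrite -dotNr -dotDr; congr dot; apply/rowP => i; rewrite !mxE; ring.
rewrite (dotDl (x - y)) !(dotDr (x - y)) (dotC (x - y) (q - p)).
lra.
Qed.

End Prox.

Lemma prox_gradient_nonexpansive (R : realType) (n : nat) (f : 'rV[R]_n -> R)
  (G : 'rV[R]_n -> 'rV[R]_n) (L : R) (g : 'rV[R]_n -> \bar R) (c : R)
  (T : 'rV[R]_n -> 'rV[R]_n) :
  convex_fun f -> has_gradient f G -> 0 < L -> lipschitz_with L G ->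
  proper_fun g -> econvex_fun g -> 0 < c <= 1 / L ->
  (forall y, is_prox (fun z => (c%:E * g z)%E) (y - c *: G y) (T y)) ->
  lipschitz_with 1 T.
Proof.
move=> cf fG L0 GL gp gc /andP[c0 cL] pT x y.
apply: le_trans (prox_nonexpansive c0 gp gc (pT x) (pT y)) _.
have := @gradient_step_le _ _ f G L 0 fG GL (convex_strongly_convex0 cf) c x y.
rewrite mulr0 subr0 normr1 addr0; apply=> //; rewrite c0 /=.
by apply: le_trans cL _; rewrite ler_pM2r ?invr_gt0 // ler1n.
Qed.

(** * Variational inequalities over fixed point sets *)

Section Nonexpansive.
Variables (R : realType) (n : nat).
Implicit Types (T W : 'rV[R]_n -> 'rV[R]_n) (x y z p : 'rV[R]_n).

(** With [v = W z - z] and [d = b - a], nonexpansiveness bounds the squares of [v + (1 - l) *: d]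
    and [v - l *: d]. Weighting them by [l] and [1 - l] cancels the cross terms and leaves
    [dot v v <= 0]. *)
Lemma Fix_convex W a b (l : R) : lipschitz_with 1 W -> 0 <= l <= 1 ->
  Fix W a -> Fix W b -> Fix W (l *: a + (1 - l) *: b).
Proof.
rewrite /Fix /= => W1 /andP[l0 l1] Wa Wb; set z := _ + _.
apply/eqP; rewrite -subr_eq0; apply/eqP/dot_le0_eq0.
have ha := dot_le (W1 z a); have hb := dot_le (W1 z b).
rewrite mul1r Wa sqr_enorm in ha; rewrite mul1r Wb sqr_enorm in hb.
have za : z - a = (1 - l) *: (b - a).
  by apply/rowP => i; rewrite !mxE; ring.
have zb : z - b = l *: (a - b) by apply/rowP => i; rewrite !mxE; ring.
have e1 : W z - a = (W z - z) + (1 - l) *: (b - a) by rewrite -za addrA subrK.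
have e2 : W z - b = (W z - z) - l *: (b - a).
  by rewrite -scalerN opprB -zb addrA subrK.
rewrite za e1 in ha; rewrite zb e2 -(opprB b a) in hb.
move: (W z - z) (b - a) ha hb => v d.
rewrite !dotE (dotC d v) => ha hb.
have ha' := ler_wpM2l l0 ha.
have hb' : 0 <= 1 - l by lra.
have := ler_wpM2l hb' hb; lra.
Qed.

Lemma nonexpansive_monotone T x y : lipschitz_with 1 T ->
  0 <= dot ((x - T x) - (y - T y)) (x - y).
Proof.
move=> T1; have -> : (x - T x) - (y - T y) = (x - y) - (T x - T y).
  by apply/rowP => i; rewrite !mxE; ring.
have h1 := T1 x y; rewrite mul1r in h1.
have h2 := dot_le_enorm (T x - T y) (x - y).
rewrite dotDl dotNl -sqr_enorm subr_ge0 (le_trans h2) // expr2.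
by rewrite ler_wpM2r ?enorm_ge0.
Qed.

Definition Fix_VI W T := [set y : 'rV[R]_n | Fix W y /\
  forall z, Fix W z -> 0 <= dot (y - T y) (z - y)].

Variables (W T : 'rV[R]_n -> 'rV[R]_n).
Hypotheses (W1 : lipschitz_with 1 W) (T1 : lipschitz_with 1 T).

(** Left to right is monotonicity of [I - T]. Conversely, test at [p + l *: d] and divide by [l]:
    [I - T] moves by at most [2 * l * enorm d], whence the quadratic coefficient. *)
Lemma minty p : Fix_VI W T p <->
  Fix W p /\ forall z, Fix W z -> 0 <= dot (z - T z) (z - p).
Proof.
split=> -[Wp h]; split=> // z Wz.
  have := nonexpansive_monotone z p T1; rewrite dotDl dotNl.
  by have := h z Wz; lra.
apply: (@ge0_of_small_quadratic _ _ (2 * dot (z - p) (z - p))) => l /andP[l0 l1].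
set d := z - p.
have e : l *: z + (1 - l) *: p = p + l *: d.
  by apply/rowP => i; rewrite !mxE; ring.
have Wl : Fix W (p + l *: d) by rewrite -e; apply: Fix_convex => //; rewrite l1 ltW.
have := h _ Wl.
have := T1 (p + l *: d) p; rewrite mul1r [p + _ - p]addrAC subrr add0r.
rewrite enormZ gtr0_norm //.
have -> : p + l *: d - T (p + l *: d) = (p - T p) + (l *: d - (T (p + l *: d) - T p)).
  by apply/rowP => i; rewrite !mxE; ring.
clearbody d; move: (T (p + l *: d) - T p) (p - T p) => v w hv.
rewrite dotZr !dotDl dotZl dotNl pmulr_rge0 // => hw.
have := ge_enormN v d.
have : enorm v * enorm d <= l * enorm d * enorm d by rewrite ler_wpM2r ?enorm_ge0.
rewrite -mulrA -expr2 sqr_enorm => h1 h2.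
have : 0 <= dot w d + l * (2 * dot d d) by lra.
by move=> /(ler_wpM2l (ltW l0)); rewrite mulr0; lra.
Qed.

(** In Minty form the unknown point enters affinely, so the inequalities are stable under convex
    combination. *)
Lemma Fix_VI_convex a b (l : R) : 0 <= l <= 1 ->
  Fix_VI W T a -> Fix_VI W T b -> Fix_VI W T (l *: a + (1 - l) *: b).
Proof.
move=> l01 /minty[Wa ha] /minty[Wb hb]; apply/minty; split; first exact: Fix_convex.
move=> z Wz; have -> : z - (l *: a + (1 - l) *: b) = l *: (z - a) + (1 - l) *: (z - b).
  by apply/rowP => i; rewrite !mxE; ring.
case/andP: l01 => l0 l1; rewrite dotDr !dotZr addr_ge0 // mulr_ge0 ?subr_ge0 //.
  exact: ha.
exact: hb.
Qed.

Lemma Fix_VI_limit_pt (x : nat -> 'rV[R]_n) P p : limit_pt x P p ->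
  (forall e, 0 < e -> \forall k \near \oo, enorm (x k - W (x k)) <= e) ->
  (forall z, Fix W z -> forall e, 0 < e ->
    \forall k \near \oo, dot (z - T z) (x k - z) <= e) ->
  Fix_VI W T p.
Proof.
move=> xp xW xT; apply/minty; split.
  apply/eqP; rewrite -subr_eq0; apply/eqP/enorm_eq0/ler_addgt0Pr => e e0.
  have e3 : 0 < e / 3 by lra.
  have [N _ hN] := xW _ e3; have [k [Nk _ xk]] := xp _ e3 N.
  have := W1 p (x k); rewrite mul1r (enormC p).
  have := enormDB (W p) (W (x k)) p; have := enormDB (W (x k)) (x k) p.
  by have := hN k Nk; rewrite /= (enormC (x k) (W _)) add0r; lra.
move=> z Wz; rewrite -oppr_le0 -dotNr opprB; apply/ler_addgt0Pr => e e0.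
have c0 : 0 < enorm (z - T z) + 1 by rewrite ltr_pwDr ?enorm_ge0.
have e2 : 0 < e / 2 by lra.
have e2' : 0 < e / 2 / (enorm (z - T z) + 1) by rewrite divr_gt0.
have [N _ hN] := xT z Wz _ e2; have [k [Nk _ xk]] := xp _ e2' N.
have -> : p - z = (x k - z) - (x k - p) by apply/rowP => i; rewrite !mxE; ring.
rewrite ltr_pdivlMr // in xk.
have := hN k Nk; have := ge_enormN (z - T z) (x k - p); have := enorm_ge0 (x k - p).
by move=> /= h0 h1 h2; rewrite dotDr dotNr; lra.
Qed.

End Nonexpansive.

(** The solution is the minimizer of [f] over [A]: a quadratic minorant at [a0] keeps a minimizing
    sequence bounded, a cluster point attains the infimum, and first-order optimality there is the
    variational inequality. *)
Lemma strongly_convex_vi_solution (R : realType) (n : nat) (f : 'rV[R]_n -> R)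
  (G : 'rV[R]_n -> 'rV[R]_n) (L mu : R) (A : set 'rV[R]_n) :
  has_gradient f G -> lipschitz_with L G -> strongly_convex mu f -> 0 < mu ->
  A !=set0 ->
  (forall a b (l : R), 0 <= l <= 1 -> A a -> A b -> A (l *: a + (1 - l) *: b)) ->
  (forall x p, (forall k, A (x k)) -> limit_pt x (fun=> True) p -> A p) ->
  exists2 p, A p & forall z, A z -> 0 <= dot (G p) (z - p).
Proof.
move=> fG GL fmu mu0 [a0 Aa0] Aconv Aclosed.
have lower y : f a0 - enorm (G a0) * enorm (y - a0) + mu / 2 * enorm (y - a0) ^+ 2 <= f y.
  have := strongly_convex_lower fG GL fmu a0 y; rewrite sqr_enorm.
  by have := ge_enormN (G a0) (y - a0); lra.
set g := enorm (G a0) in lower; have g0 : 0 <= g by exact: enorm_ge0.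
have infA : has_inf [set f y | y in A].
  split; first by exists (f a0), a0.
  exists (f a0 - g ^+ 2 / (2 * mu)) => _ [y _ <-]; apply: le_trans (lower y).
  have : 0 <= (mu * enorm (y - a0) - g) ^+ 2 / (2 * mu).
    by rewrite divr_ge0 ?sqr_ge0 // mulr_ge0 // ltW.
  have -> : (mu * enorm (y - a0) - g) ^+ 2 / (2 * mu) =
    mu / 2 * enorm (y - a0) ^+ 2 - g * enorm (y - a0) + g ^+ 2 / (2 * mu).
    by field; rewrite gt_eqF.
  lra.
set m := inf [set f y | y in A] in infA.
have /choice[y yP] k : exists y, A y /\ f y < m + k.+1%:R^-1.
  have k0 : 0 < k.+1%:R^-1 :> R by rewrite invr_gt0 ltr0n.
  by have [_ [y Ay <-] ym] := inf_adherent k0 infA; exists y.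
pose C := m + 1 - f a0.
have yb k : enorm (y k) <= enorm a0 + ((g + `|C|) * (2 / mu) + 1).
  have -> : y k = a0 + (y k - a0) by rewrite addrCA subrr addr0.
  apply: le_trans (enormD _ _) _; rewrite lerD2l.
  have := lower (y k); have [_ fy] := yP k.
  have k1 : k.+1%:R^-1 <= 1 :> R by rewrite invf_le1 ?ltr0n // ler1n.
  set t := enorm (y k - a0) => ht.
  (* Beyond this radius [t > 1], and [mu / 2 * t ^+ 2] exceeds [(g + |C|) * t], hence [g * t + |C|],
     against [f (y k) - f a0 < |C|]. *)
  rewrite leNgt; apply/negP => tb.
  have p0 : 0 <= (g + `|C|) * (2 / mu).
    by rewrite mulr_ge0 ?addr_ge0 // divr_ge0 // ltW.
  have t1 : 1 < t by lra.
  have : (g + `|C|) * (2 / mu) * mu < t * mu by rewrite ltr_pM2r //; lra.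
  have -> : (g + `|C|) * (2 / mu) * mu = (g + `|C|) * 2 by field; rewrite gt_eqF.
  move=> h; have hC := ler_norm C.
  have h2 : `|C| <= `|C| * t by rewrite ler_peMr // ltW.
  have h4 : (g + `|C|) * t < mu / 2 * t * t by rewrite ltr_pM2r //; lra.
  have fy1 : f (y k) < m + 1 by apply: lt_le_trans fy _; rewrite lerD2l.
  have CE : f (y k) - f a0 < `|C| by apply: lt_le_trans hC; rewrite /C ltrD2r.
  move: `|C| CE h2 h4 => aC CE h2 h4; rewrite expr2 in ht; lra.
have [|p yp] := bounded_limit_pt (P := fun=> True) yb; first by move=> N; exists N.
have Ap : A p by apply: Aclosed yp => k; have [] := yP k.
(* The gradient inequality at [p] bounds [f p] by [f (y k)] plus a multiple of [enorm (y k - p)],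
   which stands in for continuity. *)
have fp : f p <= m.
  apply/ler_addgt0Pr => e e0.
  have c0 : 0 < enorm (G p) + 1 by rewrite ltr_pwDr ?enorm_ge0.
  have e2 : 0 < e / 2 by lra.
  have e2' : 0 < e / 2 / (enorm (G p) + 1) by rewrite divr_gt0.
  have [N _ hN] := near_infty_natSinv_lt (PosNum e2).
  have [k [Nk _]] := yp _ e2' N; rewrite ltr_pdivlMr // => yk.
  have : f (y k) < m + e / 2.
    by have [_ /lt_trans] := yP k; apply; rewrite ltrD2l; exact: hN.
  have := strongly_convex_lower fG GL fmu p (y k).
  have := ge_enormN (G p) (y k - p); have := enorm_ge0 (y k - p).
  have : 0 <= mu / 2 * dot (y k - p) (y k - p) by rewrite mulr_ge0 ?dot_ge0 //; lra.
  lra.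
exists p => // z Az.
apply: (@ge0_of_small_quadratic _ _ (L / 2 * dot (z - p) (z - p))) => l /andP[l0 l1].
have Al : A (p + l *: (z - p)).
  have -> : p + l *: (z - p) = l *: z + (1 - l) *: p.
    by apply/rowP => i; rewrite !mxE; ring.
  by apply: Aconv => //; rewrite l1 ltW.
have mp : m <= f (p + l *: (z - p)) by apply: ge_inf; [case: infA|exists (p + l *: (z - p))].
have := lipschitz_gradient_upper fG GL p (l *: (z - p)).
by rewrite !dotZr dotZl; lra.
Qed.

(** * Sequences and the iteration *)

Section Sequences.
Variable (R : realType).

(** Use the recursion with error [c * e / 2]. Once [a k <= e], this persists; while [a k > e], each
    step lowers [a] by at least [c * e / 2 * w k], which divergence of the sum of [w] forbids
    forever. *)
Lemma sequence_decay (a w : nat -> R) (c : R) : 0 < c ->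
  (forall k, 0 <= a k) -> (forall k, 0 <= w k) -> (forall k, c * w k <= 1) ->
  (forall N A, exists m, A < \sum_(N <= k < m) w k) ->
  (forall e, 0 < e -> \forall k \near \oo, a k.+1 <= (1 - c * w k) * a k + w k * e) ->
  forall e, 0 < e -> \forall k \near \oo, a k <= e.
Proof.
move=> c0 a0 w0 w1 wdiv ha e e0.
have ce : 0 < c * e / 2 by rewrite divr_gt0 // mulr_gt0.
have [N _ hN] := ha _ ce.
have [[k0 [Nk0 ak0]]|Nex] := pselect (exists k, (N <= k)%N /\ a k <= e).
  exists k0 => // k /=; elim: k => [|k IH]; first by rewrite leqn0 => /eqP <-.
  rewrite leq_eqVlt => /predU1P[<- //|]; rewrite ltnS => k0k.
  apply: le_trans (hN k (leq_trans Nk0 k0k)) _.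
  have := IH k0k => ak.
  have h1 : 0 <= 1 - c * w k by have := w1 k; lra.
  have := ler_wpM2l h1 ak; have : 0 <= c * w k * e by rewrite !mulr_ge0 // ltW.
  lra.
exfalso; have ae k : (N <= k)%N -> e < a k.
  by move=> Nk; rewrite ltNge; apply/negP => ak; apply: Nex; exists k.
have desc m : (N <= m)%N -> a m <= a N - c * e / 2 * \sum_(N <= k < m) w k.
  elim: m => [|m IH]; first by rewrite leqn0 => /eqP <-; rewrite big_geq // mulr0 subr0.
  rewrite leq_eqVlt => /predU1P[<-|]; first by rewrite big_geq // mulr0 subr0.
  rewrite ltnS => Nm; rewrite big_nat_recr //=.
  have := IH Nm; have := hN m Nm.
  have h1 : 0 <= c * w m by rewrite mulr_ge0 // ltW.
  have := ler_wpM2l h1 (ltW (ae m Nm)); rewrite /=; lra.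
have [m hm] := wdiv N (a N / (c * e / 2)).
have Nm : (N <= m)%N.
  rewrite leqNgt; apply/negP => mN; move: hm; rewrite big_geq ?(ltnW mN) //.
  by rewrite ltNge divr_ge0 // ltW.
have := desc m Nm; have := a0 m; rewrite ltr_pdivrMr // in hm; lra.
Qed.

Lemma limn_esup_lt_near (v : nat -> R) (b : R) :
  (limn_esup (fun k => (v k)%:E) < b%:E)%E -> \forall k \near \oo, v k < b.
Proof.
move=> /ereal_inf_lt[_ [V FV <-] Vb]; apply: filterS FV => k Vk.
rewrite -lte_fin; apply: le_lt_trans Vb; apply: ereal_sup_ubound; by exists k.
Qed.

Lemma limn_esup0_near (v : nat -> R) (e : R) :
  limn_esup (fun k => (v k)%:E) = 0%E -> 0 < e -> \forall k \near \oo, v k < e.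
Proof. by move=> v0 e0; apply: limn_esup_lt_near; rewrite v0 lte_fin. Qed.

Lemma series_pinfty_tail (w : nat -> R) : series w @ \oo --> +oo ->
  forall N A, exists m, A < \sum_(N <= k < m) w k.
Proof.
move=> /cvgryPgt wdiv N A.
have [M _ hM] := wdiv (A + \sum_(0 <= k < N) w k).
have E : \sum_(0 <= k < maxn M N) w k =
    \sum_(0 <= k < N) w k + \sum_(N <= k < maxn M N) w k.
  by apply: big_cat_nat; rewrite ?leq_maxr.
exists (maxn M N); have := hM (maxn M N) (leq_maxl _ _).
by rewrite /series /= E [A + _]addrC ltrD2l.
Qed.

Lemma dist_set_adherent n (x : 'rV[R]_n) (A : set 'rV[R]_n) (e : R) : A !=set0 -> 0 < e ->
  exists2 z, A z & enorm (x - z) < dist_set x A + e.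
Proof.
move=> [a Aa] e0; have hi : has_inf [set enorm (x - a) | a in A].
  split; first by exists (enorm (x - a)), a.
  by exists 0 => _ [z _ <-]; exact: enorm_ge0.
by have [_ [z Az <-] h] := inf_adherent e0 hi; exists z.
Qed.

End Sequences.

(** * The iteration for an abstract contraction and two nonexpansive maps *)

Section Iteration.
Variables (R : realType) (n : nat) (S T W : 'rV[R]_n -> 'rV[R]_n) (q : R).
Hypotheses (q0 : 0 <= q) (q1 : q < 1).
Hypotheses (Sq : lipschitz_with q S) (T1 : lipschitz_with 1 T) (W1 : lipschitz_with 1 W).

Lemma combination_le (a b d : R) (v1 v2 v3 : 'rV[R]_n) : 0 < a < 1 -> 0 < b < 1 ->
  enorm v1 <= q * d -> enorm v2 <= d -> enorm v3 <= d ->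
  enorm (a *: v1 + ((1 - a) * b) *: v2 + ((1 - a) * (1 - b)) *: v3)
    <= (1 - (1 - q) * a) * d.
Proof.
move=> /andP[a0 a1] /andP[b0 b1] h1 h2 h3.
have ab : 0 <= (1 - a) * b by rewrite mulr_ge0 //; lra.
have ab' : 0 <= (1 - a) * (1 - b) by rewrite mulr_ge0 //; lra.
apply: le_trans (enormD _ _) _.
apply: le_trans (lerD (enormD _ _) (lexx _)) _.
rewrite !enormZ (ger0_norm ab) (ger0_norm ab') (gtr0_norm a0).
have := ler_wpM2l (ltW a0) h1; have := ler_wpM2l ab h2; have := ler_wpM2l ab' h3.
lra.
Qed.

Variables (alpha beta : nat -> R) (x : nat -> 'rV[R]_n).
Hypotheses (a01 : forall k, 0 < alpha k < 1) (b01 : forall k, 0 < beta k < 1).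
Hypothesis xE : forall k, x k.+1 = alpha k *: S (x k)
  + ((1 - alpha k) * beta k) *: T (x k) + ((1 - alpha k) * (1 - beta k)) *: W (x k).
Variable M : R.
Hypotheses (xM : forall k, enorm (x k) <= M) (SM : forall k, enorm (S (x k)) <= M)
  (TM : forall k, enorm (T (x k)) <= M) (WM : forall k, enorm (W (x k)) <= M).

(** Increments are indexed by [k.+1] and [k], so that no predecessor of 0 occurs. *)
Let delta k : R := `|beta k.+1 - beta k| + `|alpha k.+1 - alpha k|.
Let D k : R := enorm (x k.+1 - x k).

(** Split [x k.+2 - x k.+1] into the new weights applied to differences of images, which contracts,
    and the changes of the three weights applied to old images, each at most [M * delta k]. *)
Lemma step_difference k :
  D k.+1 <= (1 - (1 - q) * alpha k.+1) * D k + 3 * M * delta k.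
Proof.
rewrite {1}/D.
set a' := alpha k.+1; set a := alpha k; set b' := beta k.+1; set b := beta k.
set x' := x k.+1; set y := x k.
have -> : x k.+2 - x' =
  (a' *: (S x' - S y) + ((1 - a') * b') *: (T x' - T y)
     + ((1 - a') * (1 - b')) *: (W x' - W y))
  + ((a' - a) *: S y + ((1 - a') * b' - (1 - a) * b) *: T y
     + ((1 - a') * (1 - b') - (1 - a) * (1 - b)) *: W y).
  rewrite [X in X - _ = _](xE k.+1) [X in _ - X = _](xE k).
  rewrite -/x' -/y -/a -/a' -/b -/b'.
  by apply/rowP => i; rewrite !mxE; ring.
apply: le_trans (enormD _ _) _; apply: lerD.
  have hT := T1 x' y; have hW := W1 x' y; rewrite !mul1r in hT hW.
  exact: combination_le (a01 _) (b01 _) (Sq x' y) hT hW.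
have M0 : 0 <= M := le_trans (enorm_ge0 _) (xM k).
apply: le_trans (enormD _ _) _.
apply: le_trans (lerD (enormD _ _) (lexx _)) _; rewrite !enormZ.
have c1 : `|a' - a| <= delta k by rewrite lerDr.
have hb := ler_norm (b' - b); have ha := ler_norm (a' - a).
have hb' := ler_norm (- (b' - b)); have ha' := ler_norm (- (a' - a)).
rewrite normrN in hb'; rewrite normrN in ha'.
have /andP[A0 A1] := a01 k.+1; have /andP[B0 B1] := b01 k.
rewrite -/a' in A0 A1; rewrite -/b in B0 B1.
have n1 := normr_ge0 (a' - a); have n2 := normr_ge0 (b' - b).
have c2 : `|(1 - a') * b' - (1 - a) * b| <= delta k.
  have -> : (1 - a') * b' - (1 - a) * b = (1 - a') * (b' - b) - (a' - a) * b by ring.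
  apply: le_trans (ler_normB _ _) _; rewrite !normrM (gtr0_norm B0) gtr0_norm ?subr_gt0 //.
  by rewrite /delta -/a -/a' -/b -/b'; apply: lerD; [rewrite ler_piMl //; lra|rewrite ler_piMr //; lra].
have c3 : `|(1 - a') * (1 - b') - (1 - a) * (1 - b)| <= delta k.
  have -> : (1 - a') * (1 - b') - (1 - a) * (1 - b)
     = - ((1 - a') * (b' - b)) - (a' - a) * (1 - b) by ring.
  apply: le_trans (ler_normB _ _) _; rewrite normrN !normrM.
  rewrite (gtr0_norm (x := 1 - b)) ?subr_gt0 // gtr0_norm ?subr_gt0 //.
  by rewrite /delta -/a -/a' -/b -/b'; apply: lerD; [rewrite ler_piMl //; lra|rewrite ler_piMr //; lra].
have := ler_pM (normr_ge0 _) (enorm_ge0 _) c1 (SM k).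
have := ler_pM (normr_ge0 _) (enorm_ge0 _) c2 (TM k).
have := ler_pM (normr_ge0 _) (enorm_ge0 _) c3 (WM k).
rewrite -/y; lra.
Qed.

Hypotheses (adiv : forall N (A : R), exists m, A < \sum_(N <= k < m) alpha k).
Hypothesis dsmall : forall e : R, 0 < e ->
  \forall k \near \oo, delta k <= e * (alpha k.+1 * beta k.+1).

Let g0 : 0 < 1 - q. Proof. by rewrite subr_gt0. Qed.

Let alphaS_div N (A : R) : exists m, A < \sum_(N <= k < m) alpha k.+1.
Proof.
have [[|m] hm] := adiv N.+1 A; first by exists 0%N; move: hm; rewrite !big_geq.
by exists m; rewrite -(big_add1 _ _ N m.+1 predT alpha).
Qed.

Let galpha k : (1 - q) * alpha k <= 1.
Proof.
have q0' := q0; have q1' := q1; have /andP[A0 A1] := a01 k.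
by apply: mulr_ile1; lra.
Qed.

Let M0 : 0 <= M. Proof. exact: le_trans (enorm_ge0 _) (xM 0%N). Qed.

Lemma step_vanishes e : 0 < e -> \forall k \near \oo, D k <= e.
Proof.
move: e; apply: (@sequence_decay _ _ (fun k => alpha k.+1) (1 - q)) => //.
- by move=> k; exact: enorm_ge0.
- by move=> k; have /andP[/ltW] := a01 k.+1.
(* The added 1 covers [M = 0]; the same device recurs in later denominators. *)
move=> e e0; have e' : 0 < e / (3 * M + 1) by rewrite divr_gt0 //; have := M0; lra.
apply: filterS (dsmall e') => k hk; apply: le_trans (step_difference k) _.
rewrite lerD2l.
have /andP[A0 A1] := a01 k.+1; have /andP[B0 B1] := b01 k.+1.
have M3 : 0 <= 3 * M by rewrite mulr_ge0 ?M0.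
apply: le_trans (ler_wpM2l M3 hk) _.
have -> : 3 * M * (e / (3 * M + 1) * (alpha k.+1 * beta k.+1))
  = (alpha k.+1 * e) * ((3 * M) / (3 * M + 1) * beta k.+1) by field; lra.
apply: ler_piMr; first by rewrite mulr_ge0 ?ltW.
have : 3 * M / (3 * M + 1) <= 1 by rewrite ler_pdivrMr; lra.
move=> h; rewrite -[leRHS]mulr1; apply: ler_pM => //; last exact: ltW.
  by rewrite divr_ge0 //; lra.
exact: ltW.
Qed.

Variable K : R.
Hypotheses (K0 : 0 <= K)
  (hK : \forall k \near \oo, `|(beta k.+1)^-1 - (beta k)^-1| <= K * alpha k.+1).

(** Divide the difference estimate by [beta k.+1]. Replacing this divisor by [beta k] costs at most
    [D k * K * alpha k.+1], which is small relative to [alpha k.+1] because [D k] already tends to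
    0. *)
Lemma step_vanishes_beta e : 0 < e -> \forall k \near \oo, D k / beta k <= e.
Proof.
move: e; apply: (@sequence_decay _ _ (fun k => alpha k.+1) (1 - q)) => //.
- by move=> k; have /andP[B0 B1] := b01 k; rewrite divr_ge0 ?enorm_ge0 // ltW.
- by move=> k; have /andP[/ltW] := a01 k.+1.
move=> e e0.
have K0' := K0; have M0' := M0; have g0' := g0.
have e1 : 0 < e / 2 / (3 * M + 1) by rewrite divr_gt0 //; lra.
have e2 : 0 < e / 2 / (K + 1) by rewrite divr_gt0 //; lra.
near=> k.
have hd : delta k <= e / 2 / (3 * M + 1) * (alpha k.+1 * beta k.+1).
  by near: k; exact: dsmall.
have hD : D k <= e / 2 / (K + 1) by near: k; exact: step_vanishes.
have hk : `|(beta k.+1)^-1 - (beta k)^-1| <= K * alpha k.+1 by near: k.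
have := step_difference k.
have /andP[A0 A1] := a01 k.+1; have /andP[B0 B1] := b01 k.+1.
have D0 : 0 <= D k by exact: enorm_ge0.
have G1 := galpha k.+1.
have i0 : 0 <= (beta k.+1)^-1 by rewrite invr_ge0 ltW.
move=> /(ler_wpM2r i0) h; apply: le_trans h _; rewrite mulrDl.
have h1 : 3 * M * delta k * (beta k.+1)^-1 <= alpha k.+1 * (e / 2).
  have M3 : 0 <= 3 * M by rewrite mulr_ge0 ?M0.
  rewrite ler_pdivrMr //; apply: le_trans (ler_wpM2l M3 hd) _.
  have -> : 3 * M * (e / 2 / (3 * M + 1) * (alpha k.+1 * beta k.+1))
    = (alpha k.+1 * (e / 2) * beta k.+1) * ((3 * M) / (3 * M + 1)) by field; lra.
  apply: ler_piMr; last by rewrite ler_pdivrMr; lra.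
  by rewrite !mulr_ge0 ?ltW // invr_gt0.
have h2 : D k / beta k.+1 <= D k / beta k + alpha k.+1 * (e / 2).
  have : (beta k.+1)^-1 <= (beta k)^-1 + K * alpha k.+1.
    by have := ler_norm ((beta k.+1)^-1 - (beta k)^-1); lra.
  move=> /(ler_wpM2l D0); rewrite mulrDr => /le_trans; apply; rewrite lerD2l.
  rewrite (_ : D k * (K * alpha k.+1) = alpha k.+1 * (D k * K)); last by ring.
  apply: ler_wpM2l; first exact: ltW.
  apply: le_trans (ler_wpM2r K0 hD) _.
  rewrite mulrAC ler_pdivrMr; [|lra].
  by rewrite ler_wpM2l; lra.
have p0 : 0 <= 1 - (1 - q) * alpha k.+1 by lra.
have := ler_wpM2l p0 h2.
have h3 : (1 - (1 - q) * alpha k.+1) * (alpha k.+1 * (e / 2)) <= alpha k.+1 * (e / 2).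
  apply: ler_piMl; first by rewrite !mulr_ge0 ?ltW.
  have : 0 <= (1 - q) * alpha k.+1 by rewrite mulr_ge0 // ltW.
  lra.
by rewrite mulrDr mulrA => h4; lra.
Unshelve. all: by end_near. Qed.

Hypothesis ab : forall e : R, 0 < e -> \forall k \near \oo, alpha k <= e * beta k.
Hypothesis a_to0 : forall e : R, 0 < e -> \forall k \near \oo, alpha k <= e.

(* Pair [x_k - x_(k+1)] with [x_k - z]: the [W]-term is nonnegative, and the [T]-term
   dominates its value at [z] by monotonicity. *)
Lemma asymptotic_minty z e : Fix W z -> 0 < e ->
  \forall k \near \oo, dot (z - T z) (x k - z) <= e.
Proof.
move=> Wz e0; pose C := M + enorm z + 1.
have C0 : 0 < C by rewrite ltr_pwDr // addr_ge0 ?enorm_ge0 ?M0.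
have MC : 0 < 2 * M * C + 1 by rewrite ltr_pwDr // !mulr_ge0 ?M0 ?ltW.
have e4 : 0 < e / 4 / C by rewrite !divr_gt0.
have e4' : 0 < e / 4 / (2 * M * C + 1) by rewrite !divr_gt0.
have h2 : 0 < 1 / 2 :> R by lra.
near=> k.
have hD : D k / beta k <= e / 4 / C by near: k; exact: step_vanishes_beta.
have hab : alpha k <= e / 4 / (2 * M * C + 1) * beta k by near: k; exact: ab.
have ha : alpha k <= 1 / 2 by near: k; exact: a_to0.
have /andP[A0 A1] := a01 k; have /andP[B0 B1] := b01 k.
set d := x k - z.
have dC : enorm d <= C.
  by apply: le_trans (enormB _ _) _; have := xM k; rewrite /C; lra.
have E : x k - x k.+1 = alpha k *: (x k - S (x k))
   + ((1 - alpha k) * beta k) *: (x k - T (x k))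
   + ((1 - alpha k) * (1 - beta k)) *: (x k - W (x k)).
  by rewrite xE; apply/rowP => i; rewrite !mxE; ring.
have hx : dot (x k - x k.+1) d <= e / 4 * beta k.
  apply: le_trans (dot_le_enorm _ _) _; rewrite enormC -/(D k).
  apply: (@le_trans _ _ (D k * C)); first by rewrite ler_wpM2l ?enorm_ge0.
  by move: hD; rewrite ler_pdivrMr // mulrAC ler_pdivlMr.
rewrite E (dotDl (_ + _)) (dotDl (_ *: _)) !dotZl in hx.
have hW : 0 <= dot (x k - W (x k)) d.
  by have := nonexpansive_monotone (x k) z W1; rewrite Wz subrr subr0.
have hT : dot (z - T z) d <= dot (x k - T (x k)) d.
  by have := nonexpansive_monotone (x k) z T1; rewrite dotDl dotNl -/d; lra.
(* The [S]-term is bounded times [alpha k], hence negligible against [beta k]. *)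
have hS : - (e / 4 * beta k) <= alpha k * dot (x k - S (x k)) d.
  have s1 : - (2 * M * C) <= dot (x k - S (x k)) d.
    apply: le_trans (ge_enormN _ _); rewrite lerN2; apply: ler_pM; rewrite ?enorm_ge0 //.
    by apply: le_trans (enormB _ _) _; have := xM k; have := SM k; lra.
  have := ler_wpM2l (ltW A0) s1.
  rewrite mulrAC ler_pdivlMr // in hab.
  have : 0 <= M * C by rewrite mulr_ge0 ?M0 ?ltW.
  lra.
have p1 : 0 <= (1 - alpha k) * (1 - beta k) by rewrite mulr_ge0 //; lra.
have := mulr_ge0 p1 hW.
have p2 : 0 < (1 - alpha k) * beta k by rewrite mulr_gt0 //; lra.
have := ler_wpM2l (ltW p2) hT.
move: (dot (x k - T _) d) (dot (z - T z) d) hx => u v k3 k1 k2.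
have k4 : (1 - alpha k) * beta k * v <= e / 2 * beta k by lra.
(* Here [alpha k <= 1 / 2] absorbs the factor [1 - alpha k]. *)
have k5 : e / 2 * beta k <= (1 - alpha k) * beta k * e.
  by rewrite [leRHS]mulrAC ler_pM2r // [leRHS]mulrC ler_pM2l //; lra.
by rewrite -(ler_pM2l p2); exact: le_trans k5.
Unshelve. all: by end_near. Qed.

Hypothesis FW0 : Fix W !=set0.
Hypothesis A1 : forall e : R, 0 < e ->
  \forall k \near \oo, dist_set (x k.+1) (Fix W) <= e * beta k.
Variable C : R.
Hypotheses (C0 : 0 < C) (A2 : \forall k \near \oo, beta k ^+ 2 <= C * alpha k).

(** For a fixed point [z], the residual at [x k] is at most twice [enorm (x k - z)]; choose [z]
    almost nearest and use [beta k < 1] in the distance bound. *)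
Lemma asymptotic_Fix e : 0 < e -> \forall k \near \oo, enorm (x k - W (x k)) <= e.
Proof.
move=> e0; have e4 : 0 < e / 4 by lra.
have [N _ hN] := A1 e4; exists N.+1 => // -[|k] //= Nk.
have [z Wz xz] := dist_set_adherent (x k.+1) FW0 e4.
have := hN k Nk; have /andP[B0 B1] := b01 k.
have := W1 (x k.+1) z; rewrite mul1r Wz => h1.
have := enormDB (x k.+1) z (W (x k.+1)); rewrite (enormC z) /=.
have : e / 4 * beta k <= e / 4 by apply: ler_piMr; exact: ltW.
lra.
Qed.

Variable xs : 'rV[R]_n.
Hypotheses (xsO : Fix_VI W T xs)
  (xsVI : forall z, Fix_VI W T z -> 0 <= dot (xs - S xs) (z - xs)).

(** Otherwise the product exceeds [e] at infinitely many indices; a cluster point along these lies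
    in the solution set and contradicts the inequality defining [xs]. *)
Lemma asymptotic_VI e : 0 < e -> \forall k \near \oo, dot (S xs - xs) (x k - xs) <= e.
Proof.
move=> e0; apply: contrapT => nh.
have [|p xp] := @bounded_limit_pt _ _ x (fun k => e < dot (S xs - xs) (x k - xs)) _ xM.
  move=> N; apply: contrapT => hN; apply: nh; exists N => // k Nk /=.
  by rewrite leNgt; apply/negP => h; apply: hN; exists k.
have pO : Fix_VI W T p.
  by apply: Fix_VI_limit_pt xp _ _ => //; [exact: asymptotic_Fix|move=> z Wz e'; exact: asymptotic_minty].
have c0 : 0 < enorm (S xs - xs) + 1 by rewrite ltr_pwDr ?enorm_ge0.
have e' : 0 < e / (enorm (S xs - xs) + 1) by rewrite divr_gt0.
have [k [_ hk xk]] := xp _ e' 0%N.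
rewrite ltr_pdivlMr // in xk.
have := dot_le_enorm (S xs - xs) (x k - p); have := enorm_ge0 (x k - p).
have := xsVI pO; rewrite -(opprB (S xs)) dotNl.
have : dot (S xs - xs) (x k - xs) = dot (S xs - xs) (x k - p) + dot (S xs - xs) (p - xs).
  by rewrite -dotDr addrA subrK.
lra.
Qed.

(** Split at an almost nearest fixed point [z]: the part along [z - xs] is nonpositive because [xs]
    solves the inner inequality, and Cauchy-Schwarz handles the rest. *)
Lemma dot_fixed_le_dist k :
  dot (T xs - xs) (x k - xs) <= enorm (T xs - xs) * dist_set (x k) (Fix W).
Proof.
apply/ler_addgt0Pr => e e0.
set c := enorm _; have c0 : 0 <= c by exact: enorm_ge0.
have e' : 0 < e / (c + 1) by rewrite divr_gt0 //; lra.
have [z Wz /ltW xz] := dist_set_adherent (x k) FW0 e'.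
have := xsO.2 z Wz; rewrite -(opprB (T xs)) dotNl => h.
have -> : x k - xs = (x k - z) + (z - xs) by rewrite addrA subrK.
rewrite dotDr; have := dot_le_enorm (T xs - xs) (x k - z); rewrite -/c => h1.
have := ler_wpM2l c0 xz; rewrite mulrDr => h2.
have h3 : c * (e / (c + 1)) <= e by rewrite mulrA ler_pdivrMr; lra.
by move: (c * (e / (c + 1))) h2 h3 => e2; lra.
Qed.

Lemma iteration_cvg : x @ \oo --> xs.
Proof.
suff h e : 0 < e -> \forall k \near \oo, dot (x k - xs) (x k - xs) <= e.
  apply: enorm_cvg => e e0; apply: filterS (h (e ^+ 2) _) => [k|]; last exact: exprn_gt0.
  by apply: enorm_le; exact: ltW.
move: e; apply: (@sequence_decay _ _ alpha (1 - q)) => //.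
- by move=> k; exact: dot_ge0.
- by move=> k; have /andP[/ltW] := a01 k.
move=> e e0; set c := enorm (T xs - xs).
have c0 : 0 <= c by exact: enorm_ge0.
have e4 : 0 < e / 4 by lra.
have e' : 0 < e / 4 / (c * C + 1).
  by rewrite divr_gt0 // ltr_pwDr // mulr_ge0 // ltW.
have [N1 _ hN1] := asymptotic_VI e4.
have h1 : \forall k \near \oo, dot (S xs - xs) (x k.+1 - xs) <= e / 4.
  by exists N1 => // k Nk; apply: hN1; exact: leqW.
near=> k.
have hS : dot (S xs - xs) (x k.+1 - xs) <= e / 4 by near: k.
have hd : dist_set (x k.+1) (Fix W) <= e / 4 / (c * C + 1) * beta k.
  by near: k; exact: A1.
have hb : beta k ^+ 2 <= C * alpha k by near: k.
have /andP[al0 al1] := a01 k; have /andP[be0 be1] := b01 k.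
(* The distance bound supplies a second factor [beta k], and [beta k ^+ 2 <= C * alpha k] converts
   the product to the scale of [alpha k]. *)
have hT : beta k * dot (T xs - xs) (x k.+1 - xs) <= alpha k * (e / 4).
  apply: le_trans (ler_wpM2l (ltW be0) (dot_fixed_le_dist k.+1)) _.
  apply: le_trans (ler_wpM2l (ltW be0) (ler_wpM2l c0 hd)) _.
  have -> : beta k * (c * (e / 4 / (c * C + 1) * beta k)) =
    c * (e / 4 / (c * C + 1)) * beta k ^+ 2 by ring.
  have c' : 0 <= c * (e / 4 / (c * C + 1)) by rewrite mulr_ge0 // ltW.
  apply: le_trans (ler_wpM2l c' hb) _.
  have cC : 0 <= c * C by rewrite mulr_ge0 // ltW.
  have -> : c * (e / 4 / (c * C + 1)) * (C * alpha k) =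
    alpha k * (e / 4) * ((c * C) / (c * C + 1)) by field; lra.
  apply: ler_piMr; last by rewrite ler_pdivrMr; lra.
  by rewrite mulr_ge0 ?ltW.
set v := x k.+1 - xs; set w := x k - xs.
(* Decompose [v = a + r] with [a] contracted; since [W xs = xs], no [W]-term enters [r]. Then
   [dot v v <= dot a a + 2 * dot r v]. *)
pose a := alpha k *: (S (x k) - S xs) + ((1 - alpha k) * beta k) *: (T (x k) - T xs)
  + ((1 - alpha k) * (1 - beta k)) *: (W (x k) - xs).
pose r := alpha k *: (S xs - xs) + ((1 - alpha k) * beta k) *: (T xs - xs).
have vE : a = v - r by rewrite /a /v /r xE; apply/rowP => i; rewrite !mxE; ring.
have ha : enorm a <= (1 - (1 - q) * alpha k) * enorm w.
  have hT1 := T1 (x k) xs; have hW1 := W1 (x k) xs; rewrite !mul1r in hT1 hW1.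
  rewrite (_ : W xs = xs) in hW1; last by case: xsO.
  exact: combination_le (a01 k) (b01 k) (Sq _ _) hT1 hW1.
have := dot_le ha; rewrite exprMn sqr_enorm.
have := galpha k; have : 0 <= (1 - q) * alpha k by rewrite mulr_ge0 // ltW.
set ga := (1 - q) * alpha k => ga0 ga1.
have : (1 - ga) ^+ 2 * dot w w <= (1 - ga) * dot w w.
  by rewrite ler_wpM2r ?dot_ge0 // expr2 ler_piMr //; lra.
have rr := dot_ge0 r.
have -> : dot a a = dot v v - 2 * dot r v + dot r r.
  by rewrite vE dotDl !(dotDr v) !(dotNl, dotNr) (dotC v r); ring.
have : dot r v <= alpha k * (e / 2).
  rewrite /r dotDl !dotZl.
  have := ler_wpM2l (ltW al0) hS; rewrite -/v.
  have : (1 - alpha k) * beta k * dot (T xs - xs) v <= alpha k * (e / 4).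
    rewrite -mulrA; apply: le_trans (ler_wpM2l _ hT) _; first by rewrite subr_ge0 ltW.
    by apply: ler_piMl; [rewrite mulr_ge0 ?ltW|lra].
  lra.
lra.
Unshelve. all: by end_near. Qed.

End Iteration.

(** * Assembly in the trilevel setting *)

Unset Implicit Arguments.

Theorem mainTheorem8 (R : realType) (n : nat)
  (f1 f2 : 'rV[R]_n -> R) (gf1 gf2 : 'rV[R]_n -> 'rV[R]_n) (Lf1 Lf2 : R)
  (g1 g2 : 'rV[R]_n -> \bar R)
  (om : 'rV[R]_n -> R) (gom : 'rV[R]_n -> 'rV[R]_n) (mu Lom : R)
  (u t s : R) (S T W : 'rV[R]_n -> 'rV[R]_n)
  (alpha beta : nat -> R) (x : nat -> 'rV[R]_n) (K : R) :
  (* f1, f2 convex, differentiable with Lf_i-Lipschitz gradients *)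
  convex_fun f1 -> convex_fun f2 ->
  has_gradient f1 gf1 -> has_gradient f2 gf2 ->
  0 < Lf1 -> 0 < Lf2 -> lipschitz_with Lf1 gf1 -> lipschitz_with Lf2 gf2 ->
  (* g1, g2 proper, lsc, convex *)
  proper_fun g1 -> proper_fun g2 -> lsc_fun g1 -> lsc_fun g2 ->
  econvex_fun g1 -> econvex_fun g2 ->
  (* omega mu-strongly convex, differentiable with Lom-Lipschitz gradient *)
  0 < mu -> 0 < Lom -> strongly_convex mu om -> has_gradient om gom ->
  lipschitz_with Lom gom ->
  (* Y* and X* nonempty, with phi_i = f_i + g_i *)
  let phi1 := fun y => ((f1 y)%:E + g1 y)%E in
  let phi2 := fun y => ((f2 y)%:E + g2 y)%E in
  argmin_on phi2 setT !=set0 ->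
  argmin_on phi1 (argmin_on phi2 setT) !=set0 ->
  (* step sizes and operators *)
  0 < u <= 2 / (Lom + mu) -> 0 < t <= 1 / Lf1 -> 0 < s <= 1 / Lf2 ->
  (forall y, S y = y - u *: gom y) ->
  (forall y, is_prox (fun z => (t%:E * g1 z)%E) (y - t *: gf1 y) (T y)) ->
  (forall y, is_prox (fun z => (s%:E * g2 z)%E) (y - s *: gf2 y) (W y)) ->
  (* trilevel iteration *)
  (forall k, 0 < alpha k < 1) -> (forall k, 0 < beta k < 1) ->
  (forall k, x k.+1 = alpha k *: S (x k) + ((1 - alpha k) * beta k) *: T (x k)
                      + ((1 - alpha k) * (1 - beta k)) *: W (x k)) ->
  (* Omega nonempty *)
  let Omega := [set y | Fix W y /\
                  forall z, Fix W z -> 0 <= dot (y - T y) (z - y)] in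
  Omega !=set0 ->
  (* parameter conditions *)
  beta k / alpha k @[k --> \oo] --> +oo ->
  alpha @ \oo --> 0 ->
  series alpha @ \oo --> +oo ->
  0 < K ->
  (limn_esup (fun k => ((alpha k.+1)^-1 * `|(beta k.+1)^-1 - (beta k)^-1|)%:E)
     <= K%:E)%E ->
  limn_esup (fun k => ((`|beta k.+1 - beta k| + `|alpha k.+1 - alpha k|)
                          / (alpha k.+1 * beta k.+1))%:E) = 0%E ->
  (exists M, forall k, enorm (x k) <= M) ->
  (* (A1)' *)
  limn_esup (fun k => (dist_set (x k.+1) (Fix W) / beta k)%:E) = 0%E ->
  (* (A2) *)
  (limn_esup (fun k => (beta k ^+ 2 / alpha k)%:E) < +oo)%E ->
  exists xs, [/\ Omega xs,
     forall z, Omega z -> 0 <= dot (xs - S xs) (z - xs),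
     forall y, Omega y -> (forall z, Omega z -> 0 <= dot (y - S y) (z - y)) -> y = xs
   & x @ \oo --> xs].
Proof.
move=> cf1 cf2 fG1 fG2 Lf10 Lf20 GL1 GL2 gp1 gp2 _ _ gc1 gc2 mu0 Lom0 ommu omG omL.
move=> phi1 phi2 _ _ uL tL sL SE pT pW a01 b01 xE Omega Om0 ab a0 adiv K0 hK hd [M xM] A1 A2.
have T1 := prox_gradient_nonexpansive cf1 fG1 Lf10 GL1 gp1 gc1 tL pT.
have W1 := prox_gradient_nonexpansive cf2 fG2 Lf20 GL2 gp2 gc2 sL pW.
(* For [u <= 2 / (Lom + mu)] this factor is at most the constant [r] of the setting. *)
pose q := `|1 - u * mu|.
have q1 : q < 1.
  have /andP[u0] := uL; rewrite ler_pdivlMr ?addr_gt0 // => uL2.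
  have um : 0 < u * mu by rewrite mulr_gt0.
  have uM : 0 < u * Lom by rewrite mulr_gt0.
  by rewrite /q ltr_norml; lra.
have Sq : lipschitz_with q S.
  by move=> y z; rewrite !SE; apply: (gradient_step_le omG omL ommu) => //; rewrite addr_gt0.
have bounded_image F : lipschitz_with 1 F -> forall k, enorm (F (x k)) <= M + enorm (F 0).
  move=> F1 k; rewrite -[F (x k)](subrK (F 0)); apply: le_trans (enormD _ _) _.
  rewrite lerD2r; apply: le_trans (F1 _ _) _; by rewrite mul1r subr0.
have S1 : lipschitz_with 1 S.
  by move=> y z; apply: le_trans (Sq y z) _; apply: ler_wpM2r; [exact: enorm_ge0|exact: ltW].
pose B := M + (enorm (S 0) + enorm (T 0) + enorm (W 0)).
have nS := enorm_ge0 (S 0); have nT := enorm_ge0 (T 0); have nW := enorm_ge0 (W 0).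
have xB k : enorm (x k) <= B by have := xM k; rewrite /B; lra.
have SB k : enorm (S (x k)) <= B by have := bounded_image S S1 k; rewrite /B; lra.
have TB k : enorm (T (x k)) <= B by have := bounded_image T T1 k; rewrite /B; lra.
have WB k : enorm (W (x k)) <= B by have := bounded_image W W1 k; rewrite /B; lra.
have [|y p yO yp|xs xsO xsVI] := strongly_convex_vi_solution omG omL ommu mu0 (A := Omega) Om0.
- by move=> a b l; exact: Fix_VI_convex.
(* Closedness of [Omega]: its points have zero residual and satisfy Minty's inequality exactly, so
   both asymptotic conditions hold at once. *)
- apply: (Fix_VI_limit_pt W1 T1 yp) => [e e0|z Wz e e0]; near=> k.
    have [Wy _] := yO k; rewrite (_ : W (y k) = y k) // subrr enorm0; exact: ltW.
  have /(minty W1 T1)[_ /(_ z Wz)] := yO k.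
  by rewrite -(opprB z) dotNr => h; apply: le_trans (ltW e0); rewrite oppr_le0.
have u0 : 0 < u by case/andP: uL.
have xsVI' z : Omega z -> 0 <= dot (xs - S xs) (z - xs).
  by move=> Oz; rewrite SE subKr dotZl; apply: mulr_ge0; [exact: ltW|exact: xsVI].
exists xs; split => //.
  (* Uniqueness: adding the inequalities of [xs] and [y] gives [t0 ^+ 2 <= q * t0 ^+ 2] for their
     distance [t0], and [q < 1]. *)
  move=> y Oy yVI; apply/eqP; rewrite -subr_eq0; apply/eqP/enorm_eq0.
  have := yVI xs xsO; have := xsVI' y Oy.
  have := dot_le_enorm (S y - S xs) (y - xs).
  have := ler_wpM2r (enorm_ge0 (y - xs)) (Sq y xs); have := enorm_ge0 (y - xs).
  have E : dot (xs - S xs) (y - xs) + dot (y - S y) (xs - y)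
      = dot (S y - S xs) (y - xs) - enorm (y - xs) ^+ 2.
    rewrite sqr_enorm -(opprB y xs) dotNr -dotNl -dotDl -dotNl -dotDl.
    by congr dot; apply/rowP => i; rewrite !mxE; ring.
  move: E; set t0 := enorm (y - xs) => E t00 h1 h2 h3 h4.
  have h5 : (1 - q) * t0 ^+ 2 <= 0 by lra.
  by rewrite pmulr_rle0 ?subr_gt0 // in h5; rewrite -(ler_pXn2r (n := 2)) ?nnegrE // expr0n.
have [b hb] : exists b : R, (limn_esup (fun k => (beta k ^+ 2 / alpha k)%:E) < b%:E)%E.
  case: (limn_esup _) A2 => [r| |] // _; last by exists 0; rewrite ltNyr.
  by exists (r + 1); rewrite lte_fin ltrDl.
(* [K + 1] turns the weak limsup bound into a strict one, valid eventually; [|b| + 1] makes the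
   constant positive. *)
apply: (@iteration_cvg R n S T W q (normr_ge0 _) q1 Sq T1 W1 alpha beta x a01 b01 xE B
  xB SB TB WB _ _ (K + 1) _ _ _ _ _ _ (`|b| + 1) _ _ xs xsO xsVI').
- exact: series_pinfty_tail.
- move=> e e0; apply: filterS (limn_esup0_near hd e0) => k /ltW.
  have /andP[A0 _] := a01 k.+1; have /andP[B0 _] := b01 k.+1.
  by rewrite ler_pdivrMr ?mulr_gt0.
- lra.
- have hK1 : (limn_esup (fun k => ((alpha k.+1)^-1 * `|(beta k.+1)^-1 - (beta k)^-1|)%:E)
      < (K + 1)%:E)%E by apply: le_lt_trans hK _; rewrite lte_fin ltrDl.
  apply: filterS (limn_esup_lt_near hK1) => k /ltW.
  by have /andP[A0 _] := a01 k.+1; rewrite mulrC ler_pdivrMr.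
- move=> e e0; move/cvgryPge: ab => /(_ e^-1); apply: filterS => k.
  have /andP[A0 _] := a01 k.
  by rewrite ler_pdivlMr // mulrC ler_pdivrMr // mulrC.
- move=> e e0; move/cvgrPdist_le: a0 => /(_ e e0); apply: filterS => k.
  by have /andP[A0 _] := a01 k; rewrite sub0r normrN gtr0_norm.
- by have [z [Wz _]] := Om0; exists z.
- move=> e e0; apply: filterS (limn_esup0_near A1 e0) => k /ltW.
  by have /andP[B0 _] := b01 k; rewrite ler_pdivrMr.
- by rewrite ltr_pwDr.
- apply: filterS (limn_esup_lt_near hb) => k /ltW.
  have /andP[A0 _] := a01 k; rewrite ler_pdivrMr // => /le_trans; apply.
  by apply: ler_wpM2r; [exact: ltW|have := ler_norm b; lra].
Unshelve. all: by end_near. Qed.
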